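(* Let the format be either binary64 or binary32, with parameters $P, e_{\min}, e_{\max}, q_-, q_+$ as given in the context. Let $w\in[0,10^{19}]$ and $q$ be integers, and run the algorithm described in the context on input $(w,q)$. Then: (1) if $q\in[-27,55]$, the algorithm does not abort; (2) whenever the algorithm does not abort, the value it returns is the binary floating-point value of the chosen format nearest to the decimal number $w\times 10^q$, with ties rounded to even (including the cases where the correctly rounded result is zero, a subnormal number, or $\infty$).
   Context: Notation: for integers $n$ and $d>0$, $n\div d=\lfloor n/d\rfloor$ (floor, also for negative $n$), and $n\bmod d=n-d\lfloor n/d\rfloor$. Formats. binary64: $P=53$, $e_{\min}=-1022$, $e_{\max}=1023$, $q_-=-4$, $q_+=23$. binary32: $P=24$, $e_{\min}=-126$, $e_{\max}=127$, $q_-=-17$, $q_+=10$. The non-negative finite values of the format are the normal values $m\times 2^{p}\times 2^{-(P-1)}$ with integers $m\in[2^{P-1},2^{P})$ and $p\in[e_{\min},e_{\max}]$, and the values $m\times 2^{e_{\min}}\times 2^{-(P-1)}$ with integer $m\in[0,2^{P-1})$ (zero and the subnormals). Rounding is IEEE-754 round-to-nearest, ties to even: the nearest finite value is chosen, in case of a tie the one with even significand $m$ is chosen, and the result is $\infty$ when rounding to nearest with $P$-bit significand and unbounded exponent gives a value that is at least $2^{e_{\max}+1}$. Table $T[q]$, for integers $q\in[-342,308]$; every entry is an integer in $[2^{127},2^{128})$: - for $0\le q\le 308$: $T[q]=\lfloor 5^q\cdot 2^{j}\rfloor$, where $j\in\mathbb{Z}$ is the unique integer with $2^{127}\le 5^q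 2^j<2^{128}$; - for $-27\le q\le -1$: $T[q]=\lceil 2^{b}/5^{-q}\rceil$ with $b=127+\lceil\log_2 5^{-q}\rceil$; - for $-342\le q\le -28$: with $b=2\,(64+\lceil\log_2 5^{-q}\rceil)$ and $c=\lceil 2^{b}/5^{-q}\rceil$, $T[q]=\lfloor c/2^{k}\rfloor$, where $k\ge 0$ is the smallest integer such that $\lfloor c/2^{k}\rfloor<2^{128}$. Algorithm, on input $(w,q)$: 1. If $w=0$ or $q<-342$, return $0$. If $q>308$, return $\infty$. 2. Let $l$ be the number of leading zeros of $w$ as a 64-bit unsigned word; replace $w$ by $2^l w$ (so $w\in[2^{63},2^{64})$). 3. Compute the 128-bit truncated product $z=(T[q]\times w)\div 2^{64}$, stopping after one 64-bit multiplication if the most significant $P+2$ bits (55 bits for binary64, 26 bits for binary32) are provably exact. That is: let $z=w\times(T[q]\div 2^{64})$ (one 64-bit multiplication); if the least significant $62-P$ bits of $z\div 2^{64}$ are all ones ($9$ bits for binary64, $38$ bits for binary32), replace $z$ by $(T[q]\times w)\div 2^{64}$ (second multiplication). In either case $z$ is treated as a 128-bit integer. 4. If $z\bmod 2^{64}=2^{64}-1$ and $q\notin[-27,55]$, abort. 5. Let $m$ be the integer formed by the most significant $P+1$ bits of $z$ (54 bits for binary64, 25 bits for binary32), not counting the eventual leading zero bit, and let $u=z\div 2^{127}\in\{0,1\}$ be the most significant bit of $z$; i.e. $m=z\div 2^{127+u-(P+1)}$. 6. Let $p=((217706\times q)\div 2^{16})+63-l+u$. 7. If $p\le e_{\min}-64$,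 return $0$. 8. (Subnormals) If $p\le e_{\min}$: let $s=e_{\min}-p+1$; replace $m$ by $m\div 2^{s}$; then if $m$ is odd replace $m$ by $m+1$; then replace $m$ by $m\div 2$; return $m\times 2^{p}\times 2^{-(P-1)}$. 9. (Ties) If $z\bmod 2^{64}\le 1$, $m$ is odd, $m\div 2$ is even, $q\in[q_-,q_+]$, and $(z\div 2^{64})/m$ is a power of two (i.e. $z\div 2^{64}=2^{j}m$ for some integer $j\ge 0$), replace $m$ by $m-1$. 10. If $m$ is odd replace $m$ by $m+1$; then replace $m$ by $m\div 2$. 11. If $m=2^{P}$, replace $m$ by $m\div 2$ and $p$ by $p+1$. 12. If $p>e_{\max}$, return $\infty$. 13. Return $m\times 2^{p}\times 2^{-(P-1)}$.
   Formalization: In step 8 the formal algorithm takes s = e_min − p (not e_min − p + 1) and returns m × 2^{e_min} × 2^{-(P-1)} (not m × 2^p × 2^{-(P-1)}); as printed, binary64 with w = 5, q = −324 would return 2^{-1126} instead of the correct 2^{-1074}. *)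

(* Defs.v *)
From Stdlib Require Import ZArith Reals Bool.

Open Scope Z_scope.

Inductive format := binary64 | binary32.

Definition prec (f : format) : Z :=
  match f with binary64 => 53 | binary32 => 24 end.
Definition emin (f : format) : Z :=
  match f with binary64 => -1022 | binary32 => -126 end.
Definition emax (f : format) : Z :=
  match f with binary64 => 1023 | binary32 => 127 end.
Definition qmin (f : format) : Z :=
  match f with binary64 => -4 | binary32 => -17 end.
Definition qmax (f : format) : Z :=
  match f with binary64 => 23 | binary32 => 10 end.

(* [Finite m p] stands for m * 2^p * 2^-(P-1); it need not be normalized. *)
Inductive datum := Finite (m p : Z) | Infinity.

Definition value (f : format) (m p : Z) : R :=
  (IZR m * powerRZ 2 p * powerRZ 2 (- (prec f - 1)))%R.

(** * Round to nearest, ties to even *)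

Definition finite_repr (f : format) (m p : Z) : Prop :=
  (2 ^ (prec f - 1) <= m < 2 ^ prec f /\ emin f <= p <= emax f) \/
  (0 <= m < 2 ^ (prec f - 1) /\ p = emin f).

(* Zero is included so that 0 has a rounding; it is never nearest to x <> 0. *)
Definition unbounded_repr (f : format) (m p : Z) : Prop :=
  2 ^ (prec f - 1) <= m < 2 ^ prec f \/ m = 0.

(* Each value has only one significand under either predicate [repr] above, so
   the parity of [m] below is a property of [y]. *)
Definition nearest_even (f : format) (repr : Z -> Z -> Prop) (x y : R) : Prop :=
  exists m p : Z,
    repr m p /\ y = value f m p /\
    (forall m' p' : Z, repr m' p' ->
       (Rabs (x - y) <= Rabs (x - value f m' p'))%R) /\
    (forall m' p' : Z, repr m' p' -> value f m' p' <> y ->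
       Rabs (x - value f m' p') = Rabs (x - y) -> Z.Even m).

Definition overflows (f : format) (x : R) : Prop :=
  exists y : R, nearest_even f (unbounded_repr f) x y /\
                (powerRZ 2 (emax f + 1) <= y)%R.

(* Only for x >= 0: the formats above contain no negative values. *)
Definition correctly_rounded (f : format) (x : R) (d : datum) : Prop :=
  match d with
  | Infinity => overflows f x
  | Finite m p =>
      ~ overflows f x /\ nearest_even f (finite_repr f) x (value f m p)
  end.

(** * The table of powers of five *)

Definition cdiv (a b : Z) : Z := - (- a / b).

(* - q >= 0: the only j with 2^127 <= 5^q * 2^j < 2^128 is 127 - log2 (5^q), and
     [Z.shiftl] by a negative j is the floor division by 2^-j.
   - q <= -28: c / 2^k < 2^128 iff c < 2^(k + 128) iff log2 c - 127 <= k. *)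
Definition T (q : Z) : Z :=
  if 0 <=? q then
    let j := 127 - Z.log2 (5 ^ q) in
    Z.shiftl (5 ^ q) j
  else if -27 <=? q then
    let b := 127 + Z.log2_up (5 ^ (- q)) in
    cdiv (2 ^ b) (5 ^ (- q))
  else
    let b := 2 * (64 + Z.log2_up (5 ^ (- q))) in
    let c := cdiv (2 ^ b) (5 ^ (- q)) in
    let k := Z.max 0 (Z.log2 c - 127) in
    c / 2 ^ k.

(** * The algorithm *)

Definition leading_zeros64 (w : Z) : Z := 63 - Z.log2 w.

Definition is_pow2 (n : Z) : bool := (0 <? n) && (n =? 2 ^ Z.log2 n).

Definition round_up_if_odd (m : Z) : Z := if Z.odd m then m + 1 else m.

(* The 128-bit product, for a normalized w. *)
Definition product (f : format) (w q : Z) : Z :=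
  let z := w * (T q / 2 ^ 64) in
  let ones := 2 ^ (62 - prec f) in
  if (z / 2 ^ 64) mod ones =? ones - 1 then (T q * w) / 2 ^ 64 else z.

(* [m] has P + 1 bits and the exact value is in [m, m+1) * 2^p * 2^-P.  Bringing
   it to the exponent e_min, where subnormals live, takes a shift by e_min - p,
   followed by the usual rounding of the last bit.  Descriptions of this algorithm
   in print shift by e_min - p + 1 and scale by 2^p, which is wrong: on
   w = 22250738585072014, q = -324 that yields half of 2^-1022 in binary64. *)
Definition subnormal (f : format) (m p : Z) : datum :=
  let s := emin f - p in
  let m := m / 2 ^ s in
  let m := round_up_if_odd m in
  Finite (m / 2) (emin f).

Definition normal (f : format) (z q m p : Z) : datum :=
  let m :=
    if (z mod 2 ^ 64 <=? 1) && Z.odd m && Z.even (m / 2) &&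
       (qmin f <=? q) && (q <=? qmax f) &&
       ((z / 2 ^ 64) mod m =? 0) && is_pow2 ((z / 2 ^ 64) / m)
    then m - 1 else m in
  let m := round_up_if_odd m / 2 in
  let '(m, p) := if m =? 2 ^ prec f then (m / 2, p + 1) else (m, p) in
  if emax f <? p then Infinity else Finite m p.

(* [None] means that the algorithm aborts. *)
Definition algorithm (f : format) (w q : Z) : option datum :=
  if (w =? 0) || (q <? -342) then Some (Finite 0 0)
  else if 308 <? q then Some Infinity
  else
    let l := leading_zeros64 w in
    let w := 2 ^ l * w in
    let z := product f w q in
    if (z mod 2 ^ 64 =? 2 ^ 64 - 1) && negb ((-27 <=? q) && (q <=? 55))
    then None
    else
      let u := z / 2 ^ 127 in
      let m := z / 2 ^ (127 + u - (prec f + 1)) in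
      let p := (217706 * q) / 2 ^ 16 + 63 - l + u in
      if p <=? emin f - 64 then Some (Finite 0 0)
      else if p <=? emin f then Some (subnormal f m p)
      else Some (normal f z q m p).

(* Main.v *)
Require Import Defs.
From Stdlib Require Import ZArith Reals Bool Lia Lra List Znumtheory.

(* Let W be the normalized input and num / den = 5^q * 2^J, where J puts it in
   [2^127, 2^128).  T q is the floor of num / den, except that it is the ceiling for
   -27 <= q <= -1.  Truncation makes z so close below W * num / den / 2^64 that,
   unless the bits just under the significand m are all ones, both have the same
   leading bits, and m is the exact floor of the scaled input.  No such condition is
   needed when T q is exact, nor when it is a ceiling: the scaled input is then a
   fraction with denominator den <= 5^27, too coarse for the excess to carry the
   product past an integer.

   Knowing m, rounding is determined by its last bit, except when m is odd and the
   input may be exactly midway.  By divisibility by powers of 5, a midpoint forces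
   q into [qmin, qmax], and then z is a multiple of 2^64.  Conversely, if the tie test
   succeeds, the distance to the midpoint is a multiple of 2^127 / den, and too small
   to be nonzero; the one product not covered by this estimate, the short one with
   q < 0, is excluded by a finite computation. *)

Open Scope Z_scope.

(** * The table *)

(** [217706 / 2 ^ 16] approximates log2 10, so on the range of the table this is 127 minus the floor
    of q * log2 5, expressed through the quotient that also enters the exponent [p] of the
    algorithm. *)
Definition table_exponent (q : Z) : Z := 127 + q - 217706 * q / 2 ^ 16.

(** [Z.pow] vanishes at negative exponents, so each power goes to the side of the fraction where its
    exponent is nonnegative. *)
Definition num (q : Z) : Z := 5 ^ Z.max q 0 * 2 ^ Z.max (table_exponent q) 0.
Definition den (q : Z) : Z := 5 ^ Z.max (- q) 0 * 2 ^ Z.max (- table_exponent q) 0.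

Lemma forallb_Zseq (P : Z -> bool) (a : Z) (n : nat) :
  forallb (fun i => P (a + Z.of_nat i)) (seq 0 n) = true ->
  forall q, a <= q < a + Z.of_nat n -> P q = true.
Proof.
  intros H q Hq. rewrite forallb_forall in H.
  replace q with (a + Z.of_nat (Z.to_nat (q - a))) by lia.
  apply H, in_seq. lia.
Qed.

Lemma div_eq (a b c : Z) : 0 < b -> c * b <= a < (c + 1) * b -> a / b = c.
Proof. intros Hb H. symmetry. apply Z.div_unique with (a - c * b); lia. Qed.

Lemma div_bounds (a b : Z) : 0 < b -> a / b * b <= a < (a / b + 1) * b.
Proof. intros Hb. pose proof (Z.div_mod a b). pose proof (Z.mod_pos_bound a b). lia. Qed.

Lemma table_exponent_bounds (q : Z) :
  65536 * (127 + q - table_exponent q) <= 217706 * q < 65536 * (128 + q - table_exponent q).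
Proof.
  unfold table_exponent. pose proof (div_bounds (217706 * q) (2 ^ 16) ltac:(lia)). lia.
Qed.

(** The rational approximation of log2 10 is good only on a bounded range, so the agreement is
    computed value by value. *)
Lemma pow5_log2 (q : Z) : 0 <= q <= 308 -> Z.log2 (5 ^ q) = 127 - table_exponent q.
Proof.
  intros Hq. apply Z.eqb_eq.
  apply (forallb_Zseq (fun q => Z.log2 (5 ^ q) =? 127 - table_exponent q) 0 309); [|lia].
  vm_compute. reflexivity.
Qed.

Lemma pow5_log2_up (n : Z) : 1 <= n <= 342 ->
  Z.log2_up (5 ^ n) = table_exponent (- n) - 127.
Proof.
  intros Hn. apply Z.eqb_eq.
  apply (forallb_Zseq (fun n => Z.log2_up (5 ^ n) =? table_exponent (- n) - 127) 1 342); [|lia].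
  vm_compute. reflexivity.
Qed.

Lemma pow5_pos (n : Z) : 0 <= n -> 0 < 5 ^ n.
Proof. intros H. apply Z.pow_pos_nonneg; lia. Qed.

Lemma den_pos (q : Z) : 0 < den q.
Proof. unfold den; apply Z.mul_pos_pos; apply Z.pow_pos_nonneg; lia. Qed.

Lemma prec_cases (f : format) : prec f = 53 \/ prec f = 24.
Proof. destruct f; auto. Qed.

Lemma pow2_dvd (a b : Z) : 0 <= a <= b -> (2 ^ a | 2 ^ b).
Proof.
  intros H. exists (2 ^ (b - a)). rewrite <- Z.pow_add_r by lia. f_equal; lia.
Qed.

Lemma pow5_27 (n : Z) : 0 <= n <= 27 -> 0 < 5 ^ n <= 2 ^ 63.
Proof.
  intros H. split; [apply Z.pow_pos_nonneg; lia|].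
  transitivity (5 ^ 27); [apply Z.pow_le_mono_r; lia|]. apply Z.leb_le. reflexivity.
Qed.

Lemma cdiv_bounds (a b : Z) : 0 < b -> a <= cdiv a b * b < a + b.
Proof. intros Hb. unfold cdiv. pose proof (div_bounds (- a) b Hb). lia. Qed.

(** With a nonnegative exponent the shift goes left and loses nothing; with a negative one it is a
    floor division. *)
Lemma T_nonneg_spec (q : Z) : 0 <= q <= 308 ->
  2 ^ 127 <= T q < 2 ^ 128 /\ T q * den q <= num q < (T q + 1) * den q /\
  (0 <= table_exponent q -> T q = 5 ^ q * 2 ^ table_exponent q /\ T q * den q = num q).
Proof.
  intros Hq. unfold T. rewrite (proj2 (Z.leb_le 0 q)) by lia. cbv zeta.
  rewrite pow5_log2 by lia. pose proof (Z.log2_spec (5 ^ q) (pow5_pos q ltac:(lia))) as S.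
  rewrite pow5_log2 in S by lia. unfold Z.succ in S.
  replace (127 - (127 - table_exponent q)) with (table_exponent q) by ring.
  unfold den, num. rewrite (Z.max_r (- q)), (Z.max_l q) by lia.
  assert (HJ : table_exponent q <= 127) by (pose proof (table_exponent_bounds q); lia).
  set (J := table_exponent q) in *. clearbody J. set (t := 5 ^ q) in *. clearbody t.
  destruct (Z_le_dec 0 J).
  - rewrite Z.max_r, Z.max_l by lia. rewrite Z.shiftl_mul_pow2 by lia.
    assert (E1 : 2 ^ 127 = 2 ^ (127 - J) * 2 ^ J) by (rewrite <- Z.pow_add_r by lia; f_equal; lia).
    assert (E2 : 2 ^ 128 = 2 ^ (127 - J + 1) * 2 ^ J) by (rewrite <- Z.pow_add_r by lia; f_equal; lia).
    rewrite E1, E2. assert (0 < 2 ^ J) by (apply Z.pow_pos_nonneg; lia).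
    repeat split; try apply Z.mul_le_mono_nonneg_r; try apply Z.mul_lt_mono_pos_r; lia.
  - rewrite Z.max_l, Z.max_r by lia. rewrite Z.shiftl_div_pow2 by lia.
    assert (0 < 2 ^ (- J)) by (apply Z.pow_pos_nonneg; lia).
    pose proof (div_bounds t (2 ^ (- J)) ltac:(lia)).
    replace (127 - J) with (127 + - J) in S by ring.
    replace (127 + - J + 1) with (128 + - J) in S by ring.
    rewrite !Z.pow_add_r in S by lia.
    repeat split; try lia.
    + apply Z.div_le_lower_bound; lia.
    + apply Z.div_lt_upper_bound; lia.
Qed.

Lemma num_neg (q : Z) : -342 <= q <= -1 -> num q = 2 ^ table_exponent q.
Proof.
  intros Hq. pose proof (table_exponent_bounds q). unfold num. rewrite !Z.max_r, !Z.max_l by lia. ring.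
Qed.

Lemma den_neg (q : Z) : -342 <= q <= -1 -> den q = 5 ^ (- q).
Proof.
  intros Hq. pose proof (table_exponent_bounds q). unfold den. rewrite !Z.max_l, Z.max_r by lia. ring.
Qed.

Lemma table_exponent_neg (q : Z) : -342 <= q <= -1 -> 127 <= table_exponent q.
Proof. pose proof (table_exponent_bounds q). lia. Qed.

(** For d = 5^-q and L its rounded-up logarithm, [2 ^ L <= 2 * (d - 1)]. The slack this leaves below
    2^128 is larger than what rounding up adds. *)
Lemma T_ceil_spec (q : Z) : -27 <= q <= -1 ->
  2 ^ 127 <= T q < 2 ^ 128 /\ num q <= T q * den q < num q + den q.
Proof.
  intros Hq. rewrite num_neg, den_neg by lia. unfold T.
  rewrite (proj2 (Z.leb_gt 0 q)), (proj2 (Z.leb_le (-27) q)) by lia. cbv zeta.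
  pose proof (pow5_log2_up (- q) ltac:(lia)) as HL. rewrite Z.opp_involutive in HL.
  pose proof (Z.log2_up_spec (5 ^ (- q))) as S.
  pose proof (pow5_27 (- q) ltac:(lia)).
  assert (5 ^ 1 <= 5 ^ (- q)) by (apply Z.pow_le_mono_r; lia).
  pose proof (Z.log2_up_pos (5 ^ (- q))) as HP.
  set (L := Z.log2_up (5 ^ (- q))) in *. clearbody L.
  replace (table_exponent q) with (127 + L) by lia.
  specialize (S ltac:(lia)). specialize (HP ltac:(lia)).
  set (d := 5 ^ (- q)) in *. clearbody d.
  replace L with (Z.pred L + 1) in S at 2 by lia.
  rewrite Z.pow_add_r in S by lia.
  assert (E : 2 ^ L = 2 * 2 ^ Z.pred L) by (rewrite <- Z.pow_succ_r by lia; f_equal; lia).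
  pose proof (cdiv_bounds (2 ^ (127 + L)) d ltac:(lia)) as B.
  split; [|assumption].
  rewrite Z.pow_add_r in * by lia. rewrite E in *.
  set (t := cdiv _ _) in *. clearbody t.
  set (x := 2 ^ Z.pred L) in *. clearbody x.
  split.
  - apply Z.mul_le_mono_pos_r with d; [lia|]. lia.
  - apply Z.mul_lt_mono_pos_r with d; [lia|]. lia.
Qed.

(** Rounding up in [c] and then down in [c / 2 ^ k] still gives the floor: [c * d] exceeds
    [2 ^ (128 + 2 * L)] by less than [d <= 2 ^ L], which division by [2 ^ (1 + L)] makes smaller
    than 1. *)
Lemma T_floor_spec (q : Z) : -342 <= q <= -28 ->
  2 ^ 127 <= T q < 2 ^ 128 /\ T q * den q <= num q < (T q + 1) * den q.
Proof.
  intros Hq. rewrite num_neg, den_neg by lia. unfold T.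
  rewrite (proj2 (Z.leb_gt 0 q)), (proj2 (Z.leb_gt (-27) q)) by lia. cbv zeta.
  pose proof (pow5_log2_up (- q) ltac:(lia)) as HL. rewrite Z.opp_involutive in HL.
  pose proof (Z.log2_up_spec (5 ^ (- q))) as S.
  assert (5 ^ 1 <= 5 ^ (- q)) by (apply Z.pow_le_mono_r; lia).
  pose proof (Z.log2_up_pos (5 ^ (- q))) as HP.
  set (L := Z.log2_up (5 ^ (- q))) in *. clearbody L.
  replace (table_exponent q) with (127 + L) by lia.
  specialize (S ltac:(lia)). specialize (HP ltac:(lia)).
  set (d := 5 ^ (- q)) in *. clearbody d.
  assert (E : 2 ^ L = 2 * 2 ^ Z.pred L) by (rewrite <- Z.pow_succ_r by lia; f_equal; lia).
  pose proof (cdiv_bounds (2 ^ (2 * (64 + L))) d ltac:(lia)) as B.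
  set (c := cdiv _ _) in *. clearbody c.
  replace (2 * (64 + L)) with (128 + L + L) in B by ring.
  rewrite !Z.pow_add_r in B by lia.
  set (y := 2 ^ L) in *.
  assert (d <= y) by lia.
  (* This determines [Z.log2 c] and hence [k = 1 + L]. *)
  assert (Hc : 2 ^ (128 + L) <= c < 2 ^ (129 + L)).
  { rewrite !Z.pow_add_r by lia. fold y. split.
    - apply Z.mul_le_mono_pos_r with d; [lia|]. nia.
    - apply Z.nle_gt. intros Hge.
      assert (2 ^ 129 * y * (2 ^ Z.pred L + 1) <= c * d) by (apply Z.mul_le_mono_nonneg; lia).
      nia. }
  rewrite (Z.log2_unique c (128 + L)) by (unfold Z.succ; replace (128 + L + 1) with (129 + L) by ring; lia).
  rewrite Z.max_r by lia. replace (128 + L - 127) with (1 + L) by ring.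
  rewrite !Z.pow_add_r in * by lia. fold y in Hc |- *.
  change (2 ^ 1) with 2.
  pose proof (div_bounds c (2 * y) ltac:(lia)) as D.
  split; [split|split].
  - apply Z.div_le_lower_bound; lia.
  - apply Z.div_lt_upper_bound; lia.
  - set (t := c / (2 * y)) in *. clearbody t.
    assert (t * d * (2 * y) <= c * d) by nia.
    enough (t * d < 2 ^ 127 * y + 1) by lia.
    apply Z.mul_lt_mono_pos_r with (2 * y); lia.
  - set (t := c / (2 * y)) in *. clearbody t.
    apply Z.mul_lt_mono_pos_r with (2 * y); [lia|].
    apply Z.le_lt_trans with (c * d); [lia|]. nia.
Qed.

Lemma T_range (q : Z) : -342 <= q <= 308 -> 2 ^ 127 <= T q < 2 ^ 128.
Proof.
  intros Hq. destruct (Z_le_dec 0 q); [apply T_nonneg_spec; lia|].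
  destruct (Z_le_dec (-27) q); [apply T_ceil_spec|apply T_floor_spec]; lia.
Qed.

Lemma T_floor (q : Z) : -342 <= q <= 308 -> ~ -27 <= q <= -1 ->
  T q * den q <= num q < (T q + 1) * den q.
Proof.
  intros Hq Hn. destruct (Z_le_dec 0 q); [apply T_nonneg_spec|apply T_floor_spec]; lia.
Qed.

(** [5 ^ 55 < 2 ^ 128]: up to 55 the power of five fits in 128 bits. *)
Lemma T_exact (q : Z) : 0 <= q <= 55 -> T q * den q = num q.
Proof.
  intros Hq. apply T_nonneg_spec; [lia|]. pose proof (table_exponent_bounds q). lia.
Qed.

(** Exact entries count as ceilings without excess, so one estimate covers all q exempt from the
    abort test. *)
Lemma T_ceil (q : Z) : -27 <= q <= 55 ->
  num q <= T q * den q < num q + den q.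
Proof.
  intros Hq. destruct (Z_lt_le_dec q 0); [apply T_ceil_spec; lia|].
  rewrite T_exact by lia. pose proof (den_pos q). lia.
Qed.

(** A zero low word makes the short and the full product agree; the one further bit makes them even,
    which rules out a low word equal to 1 in the tie test. *)
Lemma T_mod_2_65 (q : Z) : 0 <= q <= 23 -> T q mod 2 ^ 65 = 0.
Proof.
  intros Hq. assert (HJ : 65 <= table_exponent q) by (pose proof (table_exponent_bounds q); lia).
  destruct (T_nonneg_spec q) as [_ [_ H]]; [lia|]. destruct H as [H _]; [lia|]. rewrite H.
  apply Z.mod_divide; [lia|]. apply Z.divide_mul_r, pow2_dvd. lia.
Qed.

(** * The truncated product *)

Definition full_product (w q z : Z) : Prop := z = T q * w / 2 ^ 64.
Definition short_product (f : format) (w q z : Z) : Prop :=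
  z = w * (T q / 2 ^ 64) /\ (z / 2 ^ 64) mod 2 ^ (62 - prec f) <> 2 ^ (62 - prec f) - 1.

Lemma product_cases (f : format) (w q : Z) :
  full_product w q (product f w q) \/ short_product f w q (product f w q).
Proof.
  unfold full_product, short_product, product. cbv zeta.
  destruct (Z.eqb_spec ((w * (T q / 2 ^ 64) / 2 ^ 64) mod 2 ^ (62 - prec f)) (2 ^ (62 - prec f) - 1)).
  - left. reflexivity.
  - right. split; [reflexivity|assumption].
Qed.

Lemma product_le (f : format) (w q : Z) : 0 <= w ->
  product f w q * 2 ^ 64 <= w * T q.
Proof.
  intros Hw. destruct (product_cases f w q) as [H|[H _]]; rewrite H.
  - pose proof (div_bounds (T q * w) (2 ^ 64)). lia.
  - pose proof (div_bounds (T q) (2 ^ 64)). nia.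
Qed.

Lemma product_range (f : format) (w q : Z) : -342 <= q <= 308 ->
  2 ^ 63 <= w < 2 ^ 64 -> 2 ^ 126 <= product f w q < 2 ^ 128.
Proof.
  intros Hq Hw. pose proof (T_range q Hq).
  pose proof (product_le f w q ltac:(lia)).
  split; [|nia].
  destruct (product_cases f w q) as [E|[E _]]; rewrite E.
  - apply Z.div_le_lower_bound; nia.
  - assert (2 ^ 63 <= T q / 2 ^ 64) by (apply Z.div_le_lower_bound; lia). nia.
Qed.

(** Dropping the low word of [T q] costs the top word of the product at most one unit. The low
    [62 - prec f] bits of that word are not all ones, so no carry leaves them. *)
Lemma short_product_div (f : format) (w q e x : Z) : 2 ^ 63 <= w < 2 ^ 64 ->
  126 - prec f <= e -> short_product f w q (product f w q) ->
  product f w q * 2 ^ 64 <= x < w * (T q + 1) ->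
  x / 2 ^ (64 + e) = product f w q / 2 ^ e.
Proof.
  intros Hw He [Hz Hones] Hx.
  set (z := product f w q) in *.
  set (ones := 2 ^ (62 - prec f)) in *.
  assert (Hp := prec_cases f).
  assert (0 < ones) by (apply Z.pow_pos_nonneg; lia).
  (* The least exponent [126 - prec f] is one word plus the [62 - prec f] tested bits. *)
  assert (Hsplit : 2 ^ e = 2 ^ 64 * ones * 2 ^ (e - (126 - prec f))).
  { unfold ones. rewrite <- !Z.pow_add_r by lia. f_equal. lia. }
  rewrite Z.pow_add_r by lia.
  rewrite <- Z.div_div by lia.
  rewrite Hsplit, <- !(Z.div_div _ (2 ^ 64 * ones)), <- !(Z.div_div _ (2 ^ 64)) by lia.
  f_equal.
  set (t := z / 2 ^ 64) in *.
  pose proof (div_bounds z (2 ^ 64) ltac:(lia)) as Bt. fold t in Bt.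
  pose proof (div_bounds t ones ltac:(lia)) as Bs.
  pose proof (Z.mod_pos_bound t ones ltac:(lia)).
  pose proof (Z.div_mod t ones ltac:(lia)).
  assert (t + 2 <= (t / ones + 1) * ones) by lia.
  assert (x < (z + 2 ^ 64) * 2 ^ 64).
  { pose proof (div_bounds (T q) (2 ^ 64) ltac:(lia)). nia. }
  apply div_eq; [lia|]. rewrite Z.div_div by lia.
  split.
  - apply Z.div_le_lower_bound; nia.
  - apply Z.div_lt_upper_bound; nia.
Qed.

(** The floor of [x / 2 ^ 64] is at most [z + 1], and the abort test excludes exactly the low word
    from which adding 1 would carry. *)
Lemma full_product_div (f : format) (w q e x : Z) : 2 ^ 63 <= w < 2 ^ 64 ->
  64 <= e -> full_product w q (product f w q) ->
  (product f w q) mod 2 ^ 64 <> 2 ^ 64 - 1 ->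
  product f w q * 2 ^ 64 <= x < w * (T q + 1) ->
  x / 2 ^ (64 + e) = product f w q / 2 ^ e.
Proof.
  intros Hw He Hz Hones Hx. unfold full_product in Hz.
  set (z := product f w q) in *.
  rewrite Z.pow_add_r by lia.
  replace e with (64 + (e - 64)) by ring.
  rewrite (Z.pow_add_r 2 64 (e - 64)) by lia.
  rewrite <- !Z.div_div by lia. f_equal.
  pose proof (div_bounds z (2 ^ 64) ltac:(lia)).
  pose proof (Z.mod_pos_bound z (2 ^ 64) ltac:(lia)).
  pose proof (Z.div_mod z (2 ^ 64) ltac:(lia)).
  pose proof (div_bounds (T q * w) (2 ^ 64) ltac:(lia)).
  assert (x < (z + 2) * 2 ^ 64) by lia.
  apply div_eq; [lia|].
  split.
  - apply Z.div_le_lower_bound; lia.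
  - apply Z.div_lt_upper_bound; lia.
Qed.

(** For [w * T q] itself the full product loses bits only through nested floor divisions, so no
    abort test is involved. *)
Lemma product_div (f : format) (w q e : Z) : 2 ^ 63 <= w < 2 ^ 64 ->
  126 - prec f <= e ->
  w * T q / 2 ^ (64 + e) = product f w q / 2 ^ e.
Proof.
  intros Hw He. pose proof (prec_cases f).
  destruct (product_cases f w q) as [Hz|Hz].
  - rewrite Hz. rewrite Z.pow_add_r by lia. rewrite <- Z.div_div by lia.
    do 2 f_equal. ring.
  - apply short_product_div; try assumption.
    pose proof (product_le f w q). lia.
Qed.

(** * The computed significand as the floor of the scaled input *)

Lemma dvd_small (d a : Z) : (d | a) -> 0 <= a < d -> a = 0.
Proof. intros H Ha. destruct (Z.eq_dec a 0); [assumption|]. apply Z.divide_pos_le in H; lia. Qed.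

(** For negative q, [num q] is a pure power of two with exponent at least 127. A difference of this
    form that is below 2^127 in absolute value must therefore vanish. *)
Lemma scaled_diff_dvd (w q m k : Z) : -27 <= q <= -1 -> 127 <= k ->
  (2 ^ 127 | w * num q - m * den q * 2 ^ k).
Proof.
  intros Hq Hk. rewrite num_neg by lia. pose proof (table_exponent_neg q ltac:(lia)).
  apply Z.divide_sub_r; apply Z.divide_mul_r; apply pow2_dvd; lia.
Qed.

(** On [-27, 55] the entry is not too small, so only the lower bound could fail, and only for a
    genuine ceiling. Elsewhere it is a floor, and the floor of the scaled input lies in the interval
    that the division lemmas handle. *)
Lemma bracket (f : format) (w q e : Z) : -342 <= q <= 308 ->
  2 ^ 63 <= w < 2 ^ 64 -> 126 - prec f <= e ->
  (product f w q mod 2 ^ 64 <> 2 ^ 64 - 1 \/ -27 <= q <= 55) ->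
  let m := product f w q / 2 ^ e in
  m * den q * 2 ^ (64 + e) <= w * num q < (m + 1) * den q * 2 ^ (64 + e).
Proof.
  intros Hq Hw He Hab m. pose proof (prec_cases f).
  pose proof (den_pos q) as Hden.
  assert (Hpow : 2 ^ 127 <= 2 ^ (64 + e)) by (apply Z.pow_le_mono_r; lia).
  assert (Hc : -27 <= q <= 55 \/ ~ -27 <= q <= 55) by lia.
  destruct Hc as [Hc|Hc].
  - pose proof (product_div f w q e Hw He) as Hm. fold m in Hm.
    pose proof (div_bounds (w * T q) (2 ^ (64 + e)) ltac:(lia)) as B. rewrite Hm in B.
    pose proof (T_ceil q ltac:(lia)) as HT.
    set (s := 2 ^ (64 + e)) in *.
    split.
    2: { apply Z.le_lt_trans with (w * T q * den q); nia. }
    destruct (Z_lt_le_dec q 0) as [H3|H3].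
    + destruct (Z_le_dec (m * den q * s) (w * num q)) as [|Hlt]; [assumption|exfalso].
      pose proof (scaled_diff_dvd w q m (64 + e) ltac:(lia) ltac:(lia)) as D. fold s in D.
      apply Z.divide_opp_r in D.
      apply dvd_small in D; [lia|].
      split; [lia|].
      assert (m * s * den q <= w * T q * den q) by (apply Z.mul_le_mono_nonneg_r; lia).
      assert (w * (T q * den q) < w * (num q + den q)) by (apply Z.mul_lt_mono_pos_l; lia).
      (* [5 ^ 27 <= 2 ^ 63] is what makes -27 the limit: the deficit stays below 2^127, the divisor
         of the difference. *)
      assert (w * den q < 2 ^ 64 * 2 ^ 63).
      { rewrite den_neg by lia. pose proof (pow5_27 (- q)). nia. }
      lia.
    + rewrite <- (T_exact q) by lia. nia.
  - assert (product f w q mod 2 ^ 64 <> 2 ^ 64 - 1) as Hab' by lia.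
    pose proof (T_floor q Hq ltac:(lia)) as HT.
    set (x := w * num q / den q).
    pose proof (div_bounds (w * num q) (den q) Hden) as Bx. fold x in Bx.
    assert (Hx : product f w q * 2 ^ 64 <= x < w * (T q + 1)).
    { pose proof (product_le f w q ltac:(lia)). split.
      - transitivity (w * T q); [assumption|]. apply Z.div_le_lower_bound; nia.
      - apply Z.div_lt_upper_bound; nia. }
    assert (Hm : x / 2 ^ (64 + e) = m).
    { destruct (product_cases f w q).
      - apply full_product_div; try assumption; lia.
      - apply short_product_div; assumption. }
    pose proof (div_bounds x (2 ^ (64 + e)) ltac:(lia)) as B. rewrite Hm in B.
    set (s := 2 ^ (64 + e)) in *. nia.
Qed.

(** * Ties *)

Lemma odd_dvd_pow2_mul (a b k : Z) : 0 <= k -> Z.odd a = true ->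
  (a | 2 ^ k * b) -> (a | b).
Proof.
  intros Hk Ha. revert b. pattern k. apply natlike_ind; [| |assumption].
  - intros b H. now rewrite Z.mul_1_l in H.
  - intros i Hi IH b H. rewrite Z.pow_succ_r, <- Z.mul_assoc in H by assumption.
    apply IH. apply Gauss with 2; [assumption|].
    apply rel_prime_sym, prime_rel_prime; [apply prime_2|].
    intros [c Hc]. rewrite Hc, Z.odd_mul, andb_false_r in Ha. discriminate.
Qed.

Lemma odd_pow5 (n : Z) : 0 <= n -> Z.odd (5 ^ n) = true.
Proof.
  intros Hn. destruct (Z.eq_dec n 0); [now subst|].
  rewrite Z.odd_pow by lia. reflexivity.
Qed.

Lemma pow5_lt_inv (a b : Z) : 5 ^ a < 5 ^ b -> 0 <= b -> a < b.
Proof. intros H Hb. apply (Z.pow_lt_mono_r_iff 5); lia. Qed.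

(** For [q >= 0], 5^q divides [m], which has only P + 1 bits. For negative q, [m * 5 ^ (- q)]
    divides [w], leaving fewer than 64 - P bits for 5^-q or exactly the bound
    [5 ^ (- q) < 2 ^ (64 - prec f)]. *)
Lemma tie_q_range (f : format) (w q m k : Z) : -342 <= q <= 308 ->
  2 ^ 63 <= w < 2 ^ 64 -> 2 ^ prec f <= m < 2 ^ (prec f + 1) -> 0 <= k ->
  Z.odd m = true -> w * num q = m * den q * 2 ^ k -> qmin f <= q <= qmax f.
Proof.
  intros Hq Hw Hm Hk Hodd H.
  assert (Hm0 : 0 < m) by (assert (0 < 2 ^ prec f) by (apply Z.pow_pos_nonneg; destruct f; simpl; lia); lia).
  destruct (Z_le_dec 0 q) as [H0|H0].
  - assert (D : (5 ^ q | m)).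
    { apply odd_dvd_pow2_mul with (Z.max (- table_exponent q) 0 + k); [lia|apply odd_pow5; lia|].
      exists (w * 2 ^ Z.max (table_exponent q) 0).
      unfold num, den in H. rewrite (Z.max_l q), (Z.max_r (- q)) in H by lia.
      rewrite Z.pow_add_r by lia. lia. }
    apply Z.divide_pos_le in D; [|assumption].
    assert (Hlt : 5 ^ q < 5 ^ (qmax f + 1)).
    { apply Z.lt_trans with (2 ^ (prec f + 1)); [lia|]. destruct f; reflexivity. }
    apply pow5_lt_inv in Hlt; destruct f; simpl in *; lia.
  - rewrite num_neg, den_neg in H by lia. pose proof (table_exponent_neg q ltac:(lia)).
    assert (D : (m * 5 ^ (- q) | w)).
    { apply odd_dvd_pow2_mul with (table_exponent q); [lia| |].
      - rewrite Z.odd_mul, Hodd, odd_pow5 by lia. reflexivity.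
      - exists (2 ^ k). lia. }
    apply Z.divide_pos_le in D; [|lia].
    pose proof (pow5_pos (- q) ltac:(lia)).
    assert (Hlt : 2 ^ prec f * 5 ^ (- q) < 2 ^ prec f * 5 ^ (- qmin f + 1)).
    { apply Z.lt_trans with (2 ^ 64); [nia|]. destruct f; reflexivity. }
    rewrite <- Z.mul_lt_mono_pos_l in Hlt by (apply Z.pow_pos_nonneg; destruct f; simpl; lia).
    apply pow5_lt_inv in Hlt; destruct f; simpl in *; lia.
Qed.

Lemma q_range_sub (f : format) (q : Z) : qmin f <= q <= qmax f -> -17 <= q <= 23.
Proof. destruct f; simpl; lia. Qed.

(** At an exact tie the excess of [T q] contributes less than [w < 2 ^ 64] to the product, and this
    is truncated away. *)
Lemma tie_product (f : format) (w q e : Z) : 2 ^ 63 <= w < 2 ^ 64 ->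
  126 - prec f <= e -> qmin f <= q <= qmax f ->
  let m := product f w q / 2 ^ e in
  w * num q = m * den q * 2 ^ (64 + e) -> product f w q = m * 2 ^ e.
Proof.
  intros Hw He Hq m H. apply q_range_sub in Hq. pose proof (prec_cases f).
  assert (Hpe : 0 < 2 ^ e) by (apply Z.pow_pos_nonneg; lia).
  pose proof (div_bounds (product f w q) (2 ^ e) Hpe) as B. fold m in B.
  pose proof (product_le f w q ltac:(lia)) as Hle.
  pose proof (T_ceil q ltac:(lia)) as HT. pose proof (den_pos q) as Hd.
  rewrite Z.pow_add_r in H by lia.
  enough (product f w q < m * 2 ^ e + 1) by lia.
  apply Z.mul_lt_mono_pos_r with (2 ^ 64); [lia|].
  apply Z.le_lt_trans with (w * T q); [assumption|].
  apply Z.mul_lt_mono_pos_r with (den q); [assumption|].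
  assert (w * (T q * den q) < w * (num q + den q)) by (apply Z.mul_lt_mono_pos_l; lia).
  assert (w * den q < 2 ^ 64 * den q) by (apply Z.mul_lt_mono_pos_r; lia).
  lia.
Qed.

(** Literally the condition inside [normal], so that it can be folded there. *)
Definition tie_test (f : format) (z q m : Z) : bool :=
  (z mod 2 ^ 64 <=? 1) && Z.odd m && Z.even (m / 2) &&
  (qmin f <=? q) && (q <=? qmax f) &&
  ((z / 2 ^ 64) mod m =? 0) && is_pow2 ((z / 2 ^ 64) / m).

Lemma is_pow2_spec (n : Z) : is_pow2 n = true <-> exists i, 0 <= i /\ n = 2 ^ i.
Proof.
  unfold is_pow2. rewrite andb_true_iff, Z.ltb_lt, Z.eqb_eq. split.
  - intros [_ H]. exists (Z.log2 n). split; [apply Z.log2_nonneg|assumption].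
  - intros [i [Hi ->]]. rewrite Z.log2_pow2 by assumption. split; [|reflexivity].
    apply Z.pow_pos_nonneg; lia.
Qed.

Lemma exact_tie_test (f : format) (w q e : Z) : -342 <= q <= 308 ->
  2 ^ 63 <= w < 2 ^ 64 -> 126 - prec f <= e ->
  let m := product f w q / 2 ^ e in
  2 ^ prec f <= m < 2 ^ (prec f + 1) -> Z.odd m = true -> Z.even (m / 2) = true ->
  w * num q = m * den q * 2 ^ (64 + e) -> tie_test f (product f w q) q m = true.
Proof.
  intros Hq Hw He m Hm Hodd Heven H. pose proof (prec_cases f).
  pose proof (tie_q_range f w q m (64 + e) Hq Hw Hm ltac:(lia) Hodd H) as Hqr.
  pose proof (tie_product f w q e Hw He Hqr H) as Hz. fold m in Hz.
  assert (Hm0 : 0 < m) by (assert (0 < 2 ^ prec f) by (apply Z.pow_pos_nonneg; lia); lia).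
  replace e with (e - 64 + 64) in Hz by ring. rewrite Z.pow_add_r in Hz by lia.
  unfold tie_test. clearbody m. rewrite Hz, Hodd, Heven.
  replace (m * (2 ^ (e - 64) * 2 ^ 64)) with (m * 2 ^ (e - 64) * 2 ^ 64) by ring.
  rewrite Z_mod_mult, Z.div_mul by lia.
  rewrite (Z.mul_comm m), Z_mod_mult, Z.div_mul by lia.
  rewrite (proj2 (Z.leb_le (qmin f) q)), (proj2 (Z.leb_le q (qmax f))) by lia.
  apply is_pow2_spec. exists (e - 64). split; [lia|reflexivity].
Qed.

(* If w * (T q / 2^64) = m * 2^e + b with b in {0, 1}, then multiplying by 5^-q gives
   w * short_residue q + 5^-q * b = d * 2^M, where M = min J (64 + e) - 64.  The size
   of w leaves d = 1 and d = 2 only, so it suffices that no such equation has a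
   solution w in [2^63, 2^64). *)
Definition short_residue (q : Z) : Z :=
  2 ^ (table_exponent q - 64) - 5 ^ (- q) * (T q / 2 ^ 64).

(** The two exponents are those of a product whose top bit is 0 or 1. The bound by [3 * 2 ^ M]
    justifies trying only two values of [d]. *)
Definition no_short_tie (f : format) (q : Z) : bool :=
  let r := short_residue q in
  let n := 5 ^ (- q) in
  (1 <=? r) && (r <=? n) &&
  forallb (fun e =>
    let M := Z.min (table_exponent q) (64 + e) - 64 in
    (2 ^ 64 * n + n <=? 3 * 2 ^ M) &&
    forallb (fun d => forallb (fun b =>
      let a := d * 2 ^ M - n * b in
      negb ((a mod r =? 0) && (2 ^ 63 <=? a / r) && (a / r <? 2 ^ 64)))
    (0 :: 1 :: nil)) (1 :: 2 :: nil))
  (126 - prec f :: 127 - prec f :: nil).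

Lemma no_short_tie_ok (f : format) (q : Z) : qmin f <= q <= -1 -> no_short_tie f q = true.
Proof.
  intros Hq.
  destruct f; simpl in Hq.
  - apply (forallb_Zseq (no_short_tie binary64) (-4) 4); [vm_compute; reflexivity|lia].
  - apply (forallb_Zseq (no_short_tie binary32) (-17) 17); [vm_compute; reflexivity|lia].
Qed.

Lemma short_not_tie_like (f : format) (w q e m r : Z) : qmin f <= q <= -1 ->
  2 ^ 63 <= w < 2 ^ 64 -> 126 - prec f <= e <= 127 - prec f ->
  0 <= r <= 1 -> w * (T q / 2 ^ 64) <> m * 2 ^ e + r.
Proof.
  intros Hq Hw He Hr H. assert (-27 <= q) by (destruct f; simpl in *; lia).
  pose proof (no_short_tie_ok f q Hq) as C. unfold no_short_tie in C.
  pose proof (prec_cases f).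
  pose proof (table_exponent_neg q ltac:(lia)).
  set (M := Z.min (table_exponent q) (64 + e) - 64).
  rewrite !andb_true_iff, !Z.leb_le in C. destruct C as [[C1 C2] C].
  assert (D : (2 ^ M | w * short_residue q + 5 ^ (- q) * r)).
  { replace (w * short_residue q + 5 ^ (- q) * r)
      with (2 ^ (table_exponent q - 64) * w - 2 ^ e * m * 5 ^ (- q)) by (unfold short_residue; lia).
    apply Z.divide_sub_r; repeat apply Z.divide_mul_l; apply pow2_dvd; lia. }
  destruct D as [d D].
  pose proof (pow5_pos (- q) ltac:(lia)).
  rewrite forallb_forall in C. specialize (C e ltac:(cbn [In]; lia)). fold M in C.
  cbv zeta in C. rewrite andb_true_iff, Z.leb_le in C. destruct C as [HM C].
  assert (0 < 2 ^ M) by (apply Z.pow_pos_nonneg; lia).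
  assert (0 < d) by nia.
  assert (w * short_residue q < 2 ^ 64 * 5 ^ (- q)) by nia.
  assert (d < 3) by nia.
  rewrite forallb_forall in C. specialize (C d ltac:(simpl; lia)).
  rewrite forallb_forall in C. specialize (C r ltac:(simpl; lia)).
  (* The candidate [a / r] in the check is now [w] itself, whose range contradicts the check. *)
  rewrite <- D in C.
  replace (w * short_residue q + 5 ^ (- q) * r - 5 ^ (- q) * r) with (w * short_residue q) in C by ring.
  rewrite Z_mod_mult, Z.div_mul in C by lia.
  rewrite (proj2 (Z.leb_le _ _)), (proj2 (Z.ltb_lt _ _)) in C by lia. discriminate.
Qed.

Lemma tie_test_exact (f : format) (w q e : Z) :
  2 ^ 63 <= w < 2 ^ 64 -> 126 - prec f <= e <= 127 - prec f ->
  let m := product f w q / 2 ^ e in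
  2 ^ prec f <= m < 2 ^ (prec f + 1) ->
  tie_test f (product f w q) q m = true -> w * num q = m * den q * 2 ^ (64 + e).
Proof.
  intros Hw He m Hm Ht. unfold tie_test in Ht.
  rewrite !andb_true_iff, is_pow2_spec, !Z.leb_le, Z.eqb_eq in Ht.
  destruct Ht as [[[[[[H1 Hodd] Heven] H2] H3] H4] [i [Hi H5]]].
  pose proof (prec_cases f) as HP.
  assert (Hqr : -17 <= q <= 23) by (apply q_range_sub with f; lia).
  assert (Hm0 : 0 < m) by (assert (0 < 2 ^ prec f) by (apply Z.pow_pos_nonneg; lia); lia).
  pose proof (bracket f w q e ltac:(lia) Hw ltac:(lia) ltac:(lia)) as [Hlo _]. fold m in Hlo.
  assert (Hpe : 0 < 2 ^ (e - 64)) by (apply Z.pow_pos_nonneg; lia).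
  assert (Hee : 2 ^ e = 2 ^ 64 * 2 ^ (e - 64)) by (rewrite <- Z.pow_add_r by lia; f_equal; lia).
  pose proof (den_pos q) as Hd.
  assert (Hz : exists r, 0 <= r <= 1 /\ product f w q = m * 2 ^ e + r).
  { exists (product f w q mod 2 ^ 64).
    pose proof (Z.mod_pos_bound (product f w q) (2 ^ 64) ltac:(lia)).
    pose proof (Z.div_mod (product f w q) (2 ^ 64) ltac:(lia)) as E.
    split; [lia|]. rewrite E at 1. rewrite Hee. f_equal.
    pose proof (Z.div_mod (product f w q / 2 ^ 64) m ltac:(lia)) as E2.
    rewrite H4, H5 in E2.
    assert (Em : m = product f w q / 2 ^ 64 / 2 ^ (e - 64)) by (rewrite Z.div_div by lia; rewrite <- Hee; reflexivity).
    pose proof (div_bounds (product f w q / 2 ^ 64) (2 ^ (e - 64)) Hpe) as B. rewrite <- Em in B.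
    rewrite E2 in B. rewrite Z.add_0_r in E2, B.
    (* The high word divided by [2 ^ (e - 64)] has floor [m], so a multiple [2 ^ i * m] of [m] can
       equal it only for this [i]. *)
    enough (i = e - 64) by (subst i; rewrite E2; ring).
    destruct (Z.lt_trichotomy i (e - 64)) as [L|[L|L]]; [exfalso|assumption|exfalso].
    - apply (Z.pow_lt_mono_r 2) in L; [nia|lia|lia].
    - assert (Hge : 2 ^ (e - 64 + 1) <= 2 ^ i) by (apply Z.pow_le_mono_r; lia).
      rewrite Z.pow_add_r in Hge by lia. nia. }
  destruct Hz as [r [Hr Hz]].
  pose proof (T_ceil q ltac:(lia)) as HT.
  rewrite Z.pow_add_r in * by lia.
  destruct (Z_lt_le_dec q 0) as [Hneg|Hpos].
  - destruct (product_cases f w q) as [P|[P _]].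
    + rewrite P in Hz. pose proof (div_bounds (T q * w) (2 ^ 64) ltac:(lia)) as B. rewrite Hz in B.
      pose proof (scaled_diff_dvd w q m (64 + e) ltac:(lia) ltac:(lia)) as D.
      rewrite Z.pow_add_r in D by lia.
      apply dvd_small in D; [lia|]. split; [lia|].
      (* With this bound the difference is at most 2 * 2^64 * 2^40, far below 2^127. *)
      assert (den q <= 2 ^ 40).
      { rewrite den_neg by lia. transitivity (5 ^ 17); [apply Z.pow_le_mono_r; lia|].
        apply Z.leb_le. reflexivity. }
      assert (w * num q <= w * (T q * den q)) by (apply Z.mul_le_mono_nonneg_l; lia).
      assert (T q * w * den q <= (m * 2 ^ e + r + 1) * 2 ^ 64 * den q) by (apply Z.mul_le_mono_nonneg_r; lia).
      nia.
    + exfalso. rewrite P in Hz. revert Hz. apply short_not_tie_like with f; lia.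
  - pose proof (T_mod_2_65 q ltac:(lia)) as M. apply Z.mod_divide in M; [|lia].
    destruct M as [t M].
    assert (Hzt : product f w q = w * t * 2).
    { destruct (product_cases f w q) as [P|[P _]]; rewrite P, M.
      - replace (t * 2 ^ 65 * w) with (w * t * 2 * 2 ^ 64) by ring. rewrite Z.div_mul by lia. ring.
      - replace (t * 2 ^ 65) with (t * 2 * 2 ^ 64) by ring. rewrite Z.div_mul by lia. ring. }
    (* Both the product and [m * 2 ^ e] are even. *)
    assert (r = 0) by lia. subst r.
    rewrite <- T_exact, M by lia.
    replace (w * (t * 2 ^ 65 * den q)) with (w * t * 2 * 2 ^ 64 * den q) by ring.
    rewrite <- Hzt, Hz. ring.
Qed.

(** * Rounding of real numbers *)

Definition pow2 (e : Z) : R := powerRZ 2 e.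

Lemma pow2_pos (e : Z) : (0 < pow2 e)%R.
Proof. apply powerRZ_lt. lra. Qed.

Lemma pow2_add (a b : Z) : pow2 (a + b) = (pow2 a * pow2 b)%R.
Proof. apply powerRZ_add. lra. Qed.

Lemma IZR_pow_nonneg (b n : Z) : 0 <= n -> IZR (b ^ n) = powerRZ (IZR b) n.
Proof.
  intros Hn. rewrite <- (Z2Nat.id n) by assumption.
  rewrite <- pow_IZR, <- pow_powerRZ. reflexivity.
Qed.

Lemma pow2_IZR (n : Z) : 0 <= n -> pow2 n = IZR (2 ^ n).
Proof. intros Hn. symmetry. apply IZR_pow_nonneg. assumption. Qed.

Lemma pow2_le (a b : Z) : a <= b -> (pow2 a <= pow2 b)%R.
Proof.
  intros H. replace b with (a + (b - a)) by ring. rewrite pow2_add.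
  assert (1 <= pow2 (b - a))%R.
  { rewrite pow2_IZR by lia. apply IZR_le.
    assert (0 < 2 ^ (b - a)) by (apply Z.pow_pos_nonneg; lia). lia. }
  pose proof (pow2_pos a). nra.
Qed.

Lemma value_pow2 (f : format) (m p : Z) : value f m p = (IZR m * pow2 (p - prec f + 1))%R.
Proof.
  unfold value. rewrite Rmult_assoc. fold (pow2 p) (pow2 (- (prec f - 1))).
  rewrite <- pow2_add. do 2 f_equal. ring.
Qed.

Lemma value_half (f : format) (m p : Z) : value f m p = (IZR (2 * m) * pow2 (p - prec f))%R.
Proof.
  rewrite value_pow2, pow2_add, mult_IZR. change (pow2 1) with (2 * 1)%R. ring.
Qed.

Lemma value_shift (f : format) (m p k : Z) : 0 <= k ->
  value f m (p + k) = value f (m * 2 ^ k) p.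
Proof.
  intros Hk. rewrite !value_pow2, mult_IZR, <- pow2_IZR by assumption.
  replace (p + k - prec f + 1) with (k + (p - prec f + 1)) by ring.
  rewrite pow2_add. ring.
Qed.

Lemma value_le (f : format) (m n p : Z) : m <= n -> (value f m p <= value f n p)%R.
Proof.
  intros H. rewrite !value_pow2. apply Rmult_le_compat_r; [apply Rlt_le, pow2_pos|].
  apply IZR_le. assumption.
Qed.

(** A value with [p >= E] is an integer number of units of exponent [E]. One with a smaller exponent
    is below [2 ^ (prec f - 1)] such units, hence below [a]. *)
Lemma value_gap (f : format) (a E m p : Z) : 0 <= m < 2 ^ prec f -> 0 <= a ->
  2 ^ (prec f - 1) <= a \/ E <= p ->
  (value f m p <= value f a E)%R \/ (value f (a + 1) E <= value f m p)%R.
Proof.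
  intros Hm Ha H. destruct (Z_le_dec E p) as [Hp|Hp].
  - replace p with (E + (p - E)) by ring. rewrite value_shift by lia.
    destruct (Z_le_dec (m * 2 ^ (p - E)) a); [left|right]; apply value_le; lia.
  - left. replace E with (p + (E - p)) by ring. rewrite value_shift by lia.
    apply value_le.
    replace (prec f) with (Z.succ (prec f - 1)) in Hm by lia.
    pose proof (prec_cases f).
    rewrite Z.pow_succ_r in Hm by lia.
    assert (2 ^ 1 <= 2 ^ (E - p)) by (apply Z.pow_le_mono_r; lia).
    nia.
Qed.

(* [r] is the rounding to nearest of x / 2^(E-P+1), where n = floor (x / 2^(E-P)). *)
Definition half_even (x : R) (n s r : Z) : Prop :=
  (Z.odd n = false -> r = n / 2) /\
  (Z.odd n = true -> x <> (IZR n * pow2 s)%R -> r = n / 2 + 1) /\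
  (Z.odd n = true -> x = (IZR n * pow2 s)%R ->
     (r = n / 2 \/ r = n / 2 + 1) /\ Z.Even r).

Lemma half_even_range (x : R) (n s r : Z) : half_even x n s r -> n / 2 <= r <= n / 2 + 1.
Proof.
  intros [H1 [H2 H3]]. destruct (Z.odd n).
  - destruct (Req_dec x (IZR n * pow2 s)%R) as [e|e].
    + destruct (H3 eq_refl e). lia.
    + rewrite (H2 eq_refl e). lia.
  - rewrite H1; lia.
Qed.

Lemma half_even_exists (x : R) (n s : Z) : exists r, half_even x n s r.
Proof.
  unfold half_even. destruct (Z.odd n).
  - destruct (Req_dec x (IZR n * pow2 s)%R) as [e|e].
    + destruct (Z.Even_or_Odd (n / 2)) as [h|h].
      * exists (n / 2). repeat split; intros; try easy; auto.
      * exists (n / 2 + 1). repeat split; intros; try easy; auto.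
        destruct h as [c ->]. exists (c + 1). ring.
    + exists (n / 2 + 1). repeat split; intros; easy.
  - exists (n / 2). repeat split; intros; easy.
Qed.

Lemma nearest_even_of_gap (f : format) (repr : Z -> Z -> Prop) (x a b : R) (m p : Z) :
  repr m p -> (a <= x <= b)%R ->
  (forall m' p', repr m' p' -> (value f m' p' <= a \/ b <= value f m' p')%R) ->
  (value f m p = a /\ 2 * x <= a + b)%R \/ (value f m p = b /\ a + b <= 2 * x)%R ->
  ((2 * x = a + b)%R -> Z.Even m) ->
  nearest_even f repr x (value f m p).
Proof.
  intros Hr Hx Hgap Hy Heven. exists m, p. split; [assumption|]. split; [reflexivity|].
  set (y := value f m p) in *. clearbody y.
  split; intros m' p' Hr'; pose proof (Hgap m' p' Hr') as G; set (v := value f m' p') in *; clearbody v.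
  - unfold Rabs. destruct (Rcase_abs (x - y)), (Rcase_abs (x - v)); lra.
  - intros Hv He. apply Heven. revert He. unfold Rabs.
    destruct (Rcase_abs (x - y)), (Rcase_abs (x - v)); lra.
Qed.

(** In half units the neighbours of [x] are [2 * (n / 2)] and two more, so an even [n] puts [x] in
    the lower half, an odd one in the upper half, with the midpoint at [n] itself. The pair [m], [p]
    is separate from [r], [E] because [r] may need renormalizing. *)
Lemma half_even_nearest (f : format) (repr : Z -> Z -> Prop) (x : R) (n E r m p : Z) :
  (IZR n * pow2 (E - prec f) <= x < IZR (n + 1) * pow2 (E - prec f))%R ->
  half_even x n (E - prec f) r ->
  repr m p -> value f m p = value f r E -> (Z.Even r -> Z.Even m) ->
  (forall m' p', repr m' p' ->
     (value f m' p' <= value f (n / 2) E \/ value f (n / 2 + 1) E <= value f m' p')%R) ->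
  nearest_even f repr x (value f m p).
Proof.
  intros Hx Hh Hr Hv Heven Hgap.
  apply nearest_even_of_gap with (value f (n / 2) E) (value f (n / 2 + 1) E); try assumption;
    rewrite ?Hv, ?value_half;
    unfold half_even in Hh; pose proof (pow2_pos (E - prec f)) as Hpos; set (h := pow2 (E - prec f)) in *;
    pose proof (Z.div_mod n 2 ltac:(lia)) as Dn; rewrite Zmod_odd in Dn;
    destruct Hh as [H1 [H2 H3]];
    set (a := n / 2) in *; clearbody a h;
    rewrite plus_IZR in Hx; rewrite ?mult_IZR, ?plus_IZR.
  - destruct (Z.odd n); rewrite Dn, ?plus_IZR, ?mult_IZR in Hx; nra.
  - destruct (Z.odd n); rewrite Dn, ?plus_IZR, ?mult_IZR in *.
    + destruct (Req_dec x ((2 * IZR a + 1) * h)) as [e|e].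
      * destruct (H3 eq_refl e) as [[-> | ->] _]; [left|right]; rewrite ?plus_IZR; split; nra.
      * rewrite (H2 eq_refl e). right. rewrite ?plus_IZR. split; nra.
    + rewrite (H1 eq_refl). left. split; nra.
  - intros Ht. apply Heven. destruct (Z.odd n) eqn:En; rewrite Dn, ?plus_IZR, ?mult_IZR in *.
    + apply H3; [reflexivity|]. nra.
    + exfalso. nra.
Qed.

(** * Rounding near the overflow threshold *)

Lemma pow2_prec (f : format) : 2 ^ prec f = 2 * 2 ^ (prec f - 1) /\ 2 ^ (prec f + 1) = 4 * 2 ^ (prec f - 1)
  /\ Z.Even (2 ^ (prec f - 1)) /\ 2 <= 2 ^ (prec f - 1).
Proof. destruct f; repeat split; try reflexivity; try (exists (2 ^ 51); reflexivity); try (exists (2 ^ 22); reflexivity); simpl; lia. Qed.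

Lemma overflows_half_even (f : format) (x : R) (n E r : Z) :
  (IZR n * pow2 (E - prec f) <= x < IZR (n + 1) * pow2 (E - prec f))%R ->
  half_even x n (E - prec f) r -> 2 ^ prec f <= n < 2 ^ (prec f + 1) ->
  emax f < E \/ (E = emax f /\ r = 2 ^ prec f) -> overflows f x.
Proof.
  intros Hx Hh Hn HE. pose proof (pow2_prec f) as [P1 [P2 [P3 P4]]].
  pose proof (half_even_range _ _ _ _ Hh) as Hr.
  assert (HA : 2 ^ (prec f - 1) <= n / 2 < 2 ^ prec f).
  { split; [apply Z.div_le_lower_bound|apply Z.div_lt_upper_bound]; lia. }
  (* A carry to [2 ^ prec f] is renormalized to the even significand [2 ^ (prec f - 1)] at the next
     exponent. *)
  assert (Hm : exists m p, unbounded_repr f m p /\ value f m p = value f r E /\ (Z.Even r -> Z.Even m)).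
  { destruct (Z.eq_dec r (2 ^ prec f)) as [e|e].
    - exists (2 ^ (prec f - 1)), (E + 1). split; [left; lia|]. split; [|auto].
      rewrite value_shift by lia. f_equal. lia.
    - exists r, E. split; [left; lia|]. split; auto. }
  destruct Hm as [m [p [Hm [Hv He]]]].
  exists (value f m p). split.
  - apply half_even_nearest with n E r; try assumption.
    intros m' p' Hr'. apply value_gap; [|lia|lia]. destruct Hr'; lia.
  - rewrite Hv. fold (pow2 (emax f + 1)).
    apply Rle_trans with (value f (2 ^ prec f) (emax f)).
    + rewrite value_pow2, <- pow2_IZR, <- pow2_add by (destruct f; simpl; lia). apply pow2_le. lia.
    + destruct HE as [HE|[-> ->]]; [|lra].
      replace E with (emax f + 1 + (E - emax f - 1)) by ring. rewrite value_shift by lia.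
      rewrite value_shift by lia. apply value_le.
      assert (1 <= 2 ^ (E - emax f - 1)) by (assert (0 < 2 ^ (E - emax f - 1)) by (apply Z.pow_pos_nonneg; lia); lia).
      change (2 ^ 1) with 2. nia.
Qed.

(** The bound is the midpoint between the largest finite value and 2^(emax + 1); below it, that
    finite value beats every [y] beyond the threshold. *)
Lemma not_overflows (f : format) (x : R) :
  (x < IZR (2 ^ (prec f + 1) - 1) * pow2 (emax f - prec f))%R -> ~ overflows f x.
Proof.
  intros Hx [y [[m [p [_ [_ [Hn _]]]]] Hge]].
  pose proof (pow2_prec f) as [P1 [P2 [P3 P4]]].
  specialize (Hn (2 ^ prec f - 1) (emax f) ltac:(left; lia)).
  rewrite value_half in Hn.
  replace (emax f + 1) with (prec f + 1 + (emax f - prec f)) in Hge by ring.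
  fold (pow2 (prec f + 1 + (emax f - prec f))) in Hge.
  rewrite pow2_add, pow2_IZR in Hge by (destruct f; simpl; lia).
  replace (2 * (2 ^ prec f - 1)) with (2 ^ (prec f + 1) - 2) in Hn by lia.
  pose proof (pow2_pos (emax f - prec f)).
  rewrite minus_IZR in *.
  set (h := pow2 (emax f - prec f)) in *. set (Q := IZR (2 ^ (prec f + 1))) in *. clearbody h Q.
  revert Hn. unfold Rabs. destruct (Rcase_abs (x - y)), (Rcase_abs (x - (Q - 2) * h)); nra.
Qed.

Lemma correctly_rounded_finite (f : format) (x : R) (n E r M p : Z) :
  (IZR n * pow2 (E - prec f) <= x < IZR (n + 1) * pow2 (E - prec f))%R ->
  half_even x n (E - prec f) r -> 0 <= n < 2 ^ (prec f + 1) ->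
  emin f <= E <= emax f -> 2 ^ prec f <= n \/ E = emin f ->
  E < emax f \/ r <> 2 ^ prec f ->
  value f M p = value f r E ->
  correctly_rounded f x (Finite M p).
Proof.
  intros Hx Hh Hn HE Hnorm Hr' HM. pose proof (pow2_prec f) as [P1 [P2 [P3 P4]]].
  pose proof (half_even_range _ _ _ _ Hh) as Hr.
  assert (HA : 0 <= n / 2 < 2 ^ prec f).
  { split; [apply Z.div_le_lower_bound|apply Z.div_lt_upper_bound]; lia. }
  assert (HA' : 2 ^ (prec f - 1) <= n / 2 \/ E = emin f).
  { destruct Hnorm; [left|right; assumption]. apply Z.div_le_lower_bound; lia. }
  assert (Hme : emin f < emax f) by (destruct f; reflexivity).
  split.
  - apply not_overflows. eapply Rlt_le_trans; [apply Hx|].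
    destruct (Z.eq_dec E (emax f)) as [e|e].
    + subst E. apply Rmult_le_compat_r; [apply Rlt_le, pow2_pos|]. apply IZR_le.
      (* This [n] is odd and always rounds up to [2 ^ prec f], even at the midpoint, since
         [2 ^ prec f - 1] is odd. *)
      destruct (Z.eq_dec n (2 ^ (prec f + 1) - 1)) as [e|e]; [exfalso|lia].
      destruct Hr' as [Hr'|Hr']; [lia|]. apply Hr'. destruct Hh as [_ [H2 H3]].
      assert (Ho : Z.odd n = true).
      { rewrite e, P2.
        replace (4 * 2 ^ (prec f - 1) - 1) with (1 + 2 * (2 * 2 ^ (prec f - 1) - 1)) by ring.
        rewrite Z.odd_add_mul_2. reflexivity. }
      assert (Hd : n / 2 = 2 ^ prec f - 1) by (apply div_eq; lia).
      destruct (Req_dec x (IZR n * pow2 (emax f - prec f))) as [t|t].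
      * destruct (H3 Ho t) as [[Hq|Hq] He]; [exfalso|lia].
        rewrite Hq, Hd in He. destruct He as [c He]. lia.
      * rewrite (H2 Ho t). lia.
    + replace (emax f - prec f) with (emax f - E + (E - prec f)) by ring.
      rewrite (pow2_add (emax f - E)), <- Rmult_assoc.
      apply Rmult_le_compat_r; [apply Rlt_le, pow2_pos|].
      rewrite pow2_IZR, <- mult_IZR by lia. apply IZR_le.
      assert (2 ^ 1 <= 2 ^ (emax f - E)) by (apply Z.pow_le_mono_r; lia). nia.
  - rewrite HM.
    assert (Hm : exists m p, finite_repr f m p /\ value f m p = value f r E /\ (Z.Even r -> Z.Even m)).
    { destruct (Z.eq_dec r (2 ^ prec f)) as [e|e].
      - exists (2 ^ (prec f - 1)), (E + 1). split; [left; lia|]. split; [|auto].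
        rewrite value_shift by lia. f_equal. lia.
      - exists r, E. split; [|split; auto].
        destruct (Z_le_dec (2 ^ (prec f - 1)) r); [left; lia|right; lia]. }
    destruct Hm as [m [p' [Hm [Hv He]]]]. rewrite <- Hv.
    apply half_even_nearest with n E r; try assumption.
    intros m' p'' Hr''. apply value_gap; [destruct Hr''; lia|lia|]. destruct Hr''; lia.
Qed.

(** * Correctness *)

Lemma IZR_pow5_split (q : Z) :
  IZR (5 ^ Z.max q 0) = (IZR (5 ^ Z.max (- q) 0) * powerRZ 5 q)%R.
Proof.
  rewrite !IZR_pow_nonneg, <- powerRZ_add by (lia || lra). f_equal. lia.
Qed.

Lemma IZR_pow2_split (q : Z) :
  IZR (2 ^ Z.max q 0) = (IZR (2 ^ Z.max (- q) 0) * pow2 q)%R.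
Proof.
  rewrite <- !pow2_IZR, <- pow2_add by lia. f_equal. lia.
Qed.

Lemma powerRZ_10 (q : Z) : powerRZ 10 q = (powerRZ 5 q * pow2 q)%R.
Proof. unfold pow2. rewrite <- powerRZ_mult. f_equal. lra. Qed.

(** The ratio of [2 ^ l * w * num q] to w * 10^q: the power 5^q cancels, and the 2^q contained in
    10^q accounts for [- q]. *)
Definition scale_factor (l q : Z) : R := (IZR (den q) * pow2 (l + table_exponent q - q))%R.

Lemma scale_factor_pos (l q : Z) : (0 < scale_factor l q)%R.
Proof.
  apply Rmult_lt_0_compat; [apply IZR_lt, den_pos|apply pow2_pos].
Qed.

Lemma scaled_input (w q l : Z) : 0 <= l ->
  IZR (2 ^ l * w * num q) = (IZR w * powerRZ 10 q * scale_factor l q)%R.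
Proof.
  intros Hl. unfold scale_factor, num, den.
  replace (l + table_exponent q - q) with (l + (table_exponent q + - q)) by ring.
  rewrite !mult_IZR, IZR_pow5_split, IZR_pow2_split, powerRZ_10, !pow2_add, (pow2_IZR l) by assumption.
  assert (E : (pow2 q * pow2 (- q) = 1)%R) by (rewrite <- pow2_add, Z.add_opp_diag_r; reflexivity).
  transitivity (IZR (2 ^ l) * IZR w *
    (IZR (5 ^ Z.max (- q) 0) * powerRZ 5 q *
     (IZR (2 ^ Z.max (- table_exponent q) 0) * pow2 (table_exponent q))) * (pow2 q * pow2 (- q)))%R;
    [rewrite E|]; ring.
Qed.

Lemma scaled_significand (m q l k s : Z) : 0 <= k -> s + l + table_exponent q - q = k ->
  IZR (m * den q * 2 ^ k) = (IZR m * pow2 s * scale_factor l q)%R.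
Proof.
  intros Hk H. unfold scale_factor. rewrite !mult_IZR, <- pow2_IZR by assumption.
  replace k with (s + (l + table_exponent q - q)) by lia. rewrite (pow2_add s). ring.
Qed.

(** A dyadic value would force 5^-q to divide [w], but [5 ^ 28] exceeds 10^19. This is why the
    subnormal branch can do without a tie test. *)
Lemma dyadic_no_tie (w q a s : Z) : 0 < w <= 10 ^ 19 -> q <= -28 ->
  (IZR w * powerRZ 10 q)%R <> (IZR a * pow2 s)%R.
Proof.
  intros Hw Hq H. rewrite powerRZ_10 in H.
  assert (D : (5 ^ (- q) | w)).
  { apply odd_dvd_pow2_mul with (Z.max (q - s) 0); [lia|apply odd_pow5; lia|].
    exists (a * 2 ^ Z.max (- (q - s)) 0). apply eq_IZR.
    rewrite !mult_IZR, IZR_pow2_split, (IZR_pow_nonneg 5) by lia.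
    set (y := IZR (2 ^ Z.max (- (q - s)) 0)). clearbody y.
    assert (E5 : (powerRZ 5 q * powerRZ 5 (- q) = 1)%R) by (rewrite <- powerRZ_add, Z.add_opp_diag_r by lra; reflexivity).
    assert (E2 : (pow2 s * pow2 (- s) = 1)%R) by (rewrite <- pow2_add, Z.add_opp_diag_r; reflexivity).
    replace (q - s) with (q + - s) by ring. rewrite pow2_add.
    transitivity (IZR w * (powerRZ 5 q * pow2 q) * (y * pow2 (- s) * powerRZ 5 (- q)))%R.
    - transitivity (y * pow2 q * pow2 (- s) * IZR w * (powerRZ 5 q * powerRZ 5 (- q)))%R; [rewrite E5|]; ring.
    - rewrite H. transitivity (IZR a * y * powerRZ 5 (- q) * (pow2 s * pow2 (- s)))%R; [|rewrite E2]; ring. }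
  apply Z.divide_pos_le in D; [|lia].
  assert (5 ^ 28 <= 5 ^ (- q)) by (apply Z.pow_le_mono_r; lia).
  assert (10 ^ 19 < 5 ^ 28) by reflexivity. lia.
Qed.

Lemma input_pos (w q : Z) : 0 < w -> (0 < IZR w * powerRZ 10 q)%R.
Proof.
  intros Hw. apply Rmult_lt_0_compat; [apply IZR_lt; assumption|apply powerRZ_lt; lra].
Qed.

(** The bound is half the least subnormal; being strict, it excludes the tie. *)
Lemma correctly_rounded_zero (f : format) (x : R) :
  (0 <= x < pow2 (emin f - prec f))%R -> correctly_rounded f x (Finite 0 0).
Proof.
  intros Hx. pose proof (pow2_prec f).
  apply correctly_rounded_finite with 0 (emin f) 0.
  - rewrite Rmult_0_l, Rmult_1_l. assumption.
  - repeat split; easy.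
  - lia.
  - destruct f; simpl; lia.
  - right. reflexivity.
  - right. lia.
  - unfold value. ring.
Qed.

Lemma tiny_input (f : format) (w q : Z) : 0 <= w <= 10 ^ 19 -> q < -342 ->
  (0 <= IZR w * powerRZ 10 q < pow2 (emin f - prec f))%R.
Proof.
  intros Hw Hq.
  assert (Hpos : (0 < powerRZ 10 q)%R) by (apply powerRZ_lt; lra).
  split; [apply Rmult_le_pos; [apply IZR_le; lia|lra]|].
  (* -1075 is [emin f - prec f] for binary64, the smaller of the two formats' bounds. *)
  apply Rlt_le_trans with (pow2 (-1075)); [|apply pow2_le; destruct f; simpl; lia].
  apply Rmult_lt_reg_r with (powerRZ 10 (- q) * pow2 1075)%R.
  { apply Rmult_lt_0_compat; [apply powerRZ_lt; lra|apply pow2_pos]. }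
  assert (E1 : (powerRZ 10 q * powerRZ 10 (- q) = 1)%R) by (rewrite <- powerRZ_add, Z.add_opp_diag_r by lra; reflexivity).
  assert (E2 : (pow2 (-1075) * pow2 1075 = 1)%R) by (rewrite <- pow2_add; reflexivity).
  replace (pow2 (-1075) * (powerRZ 10 (- q) * pow2 1075))%R
    with (powerRZ 10 (- q) * (pow2 (-1075) * pow2 1075))%R by ring.
  replace (IZR w * powerRZ 10 q * (powerRZ 10 (- q) * pow2 1075))%R
    with (IZR w * pow2 1075 * (powerRZ 10 q * powerRZ 10 (- q)))%R by ring.
  rewrite E1, E2, !Rmult_1_r, <- IZR_pow_nonneg, pow2_IZR, <- mult_IZR by lia.
  apply IZR_lt.
  apply Z.lt_le_trans with (10 ^ 343); [|apply Z.pow_le_mono_r; lia].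
  apply Z.le_lt_trans with (10 ^ 19 * 2 ^ 1075).
  - apply Z.mul_le_mono_nonneg_r; lia.
  - apply Z.ltb_lt. vm_compute. reflexivity.
Qed.

(** [10 ^ 309] already exceeds 2^1024, so the binary exponent of the input is above [emax f] in both
    formats. *)
Lemma huge_input (f : format) (w q : Z) : 0 < w -> 308 < q ->
  overflows f (IZR w * powerRZ 10 q)%R.
Proof.
  intros Hw Hq.
  change 10%R with (IZR 10). rewrite <- IZR_pow_nonneg, <- mult_IZR by lia.
  set (x := w * 10 ^ q).
  assert (Hx : 2 ^ 1024 <= x).
  { apply Z.le_trans with (10 ^ 309); [apply Z.leb_le; vm_compute; reflexivity|].
    assert (10 ^ 309 <= 10 ^ q) by (apply Z.pow_le_mono_r; lia).
    assert (0 < 10 ^ q) by (apply Z.pow_pos_nonneg; lia). nia. }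
  assert (Hl : 1024 <= Z.log2 x) by (apply Z.log2_le_pow2; lia).
  pose proof (Z.log2_spec x ltac:(lia)) as S.
  set (E := Z.log2 x) in *. clearbody E x.
  pose proof (prec_cases f).
  assert (HP : 0 < 2 ^ (E - prec f)) by (apply Z.pow_pos_nonneg; lia).
  pose proof (div_bounds x (2 ^ (E - prec f)) HP) as B.
  set (n := x / 2 ^ (E - prec f)) in *.
  destruct (half_even_exists (IZR x) n (E - prec f)) as [r Hr].
  apply overflows_half_even with n E r; try assumption.
  - rewrite pow2_IZR, <- !mult_IZR by lia. split; [apply IZR_le|apply IZR_lt]; lia.
  - split; [apply Z.div_le_lower_bound|apply Z.div_lt_upper_bound]; try assumption;
      rewrite <- Z.pow_add_r by lia.
    + replace (E - prec f + prec f) with E by ring. lia.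
    + replace (E - prec f + (prec f + 1)) with (Z.succ E) by lia. lia.
  - left. destruct f; simpl; lia.
Qed.

(** * The subnormal and normal branches *)

Lemma round_up_if_odd_half (n : Z) :
  round_up_if_odd n / 2 = if Z.odd n then n / 2 + 1 else n / 2.
Proof.
  unfold round_up_if_odd. destruct (Z.odd n) eqn:E; [|reflexivity].
  pose proof (Z.div_mod n 2 ltac:(lia)) as D. rewrite Zmod_odd, E in D.
  apply div_eq; lia.
Qed.

(** Shifting a floor gives the floor at the coarser unit, and as [x] is not dyadic, an odd last bit
    always means rounding up. *)
Lemma subnormal_correct (f : format) (x : R) (m p : Z) :
  (IZR m * pow2 (p - prec f) <= x < IZR (m + 1) * pow2 (p - prec f))%R ->
  0 <= m < 2 ^ (prec f + 1) -> p <= emin f ->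
  (forall a s, x <> (IZR a * pow2 s)%R) ->
  correctly_rounded f x (subnormal f m p).
Proof.
  intros Hx Hm Hp Hnt. unfold subnormal. cbv zeta.
  assert (HP : 0 < 2 ^ (emin f - p)) by (apply Z.pow_pos_nonneg; lia).
  pose proof (div_bounds m (2 ^ (emin f - p)) HP) as B.
  set (n := m / 2 ^ (emin f - p)) in *.
  assert (Hn : 0 <= n < 2 ^ (prec f + 1)).
  { split; [apply Z.div_pos; lia|]. apply Z.le_lt_trans with m; [|lia].
    apply Z.div_le_upper_bound; nia. }
  apply correctly_rounded_finite with n (emin f) (round_up_if_odd n / 2).
  - replace (emin f - prec f) with (emin f - p + (p - prec f)) by ring.
    rewrite pow2_add, <- !Rmult_assoc, pow2_IZR, <- !mult_IZR by lia.
    pose proof (pow2_pos (p - prec f)).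
    split.
    + eapply Rle_trans; [|apply Hx]. apply Rmult_le_compat_r; [lra|]. apply IZR_le. lia.
    + eapply Rlt_le_trans; [apply Hx|]. apply Rmult_le_compat_r; [lra|]. apply IZR_le. lia.
  - rewrite round_up_if_odd_half.
    split; [|split]; intros Ho; rewrite Ho; try easy.
    intros He. exfalso. apply (Hnt _ _ He).
  - assumption.
  - destruct f; simpl; lia.
  - right. reflexivity.
  - left. destruct f; simpl; lia.
  - reflexivity.
Qed.

(** The tie test matters only for odd [m] with even [m / 2]: if [m / 2] is odd, rounding up is right
    both at and above the midpoint. *)
Lemma normal_correct (f : format) (x : R) (z q m p : Z) :
  (IZR m * pow2 (p - prec f) <= x < IZR (m + 1) * pow2 (p - prec f))%R ->
  2 ^ prec f <= m < 2 ^ (prec f + 1) -> emin f <= p ->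
  (Z.odd m = true -> Z.even (m / 2) = true ->
     tie_test f z q m = true <-> x = (IZR m * pow2 (p - prec f))%R) ->
  correctly_rounded f x (normal f z q m p).
Proof.
  intros Hx Hm Hp Ht. unfold normal. fold (tie_test f z q m). cbv zeta.
  pose proof (pow2_prec f) as [P1 [P2 [P3 P4]]].
  set (r := round_up_if_odd _ / 2).
  assert (Hh : half_even x m (p - prec f) r).
  { assert (Hr : r = if Z.odd m && negb (tie_test f z q m) then m / 2 + 1 else m / 2).
    { unfold r. destruct (tie_test f z q m) eqn:E.
      - assert (Ho : Z.odd m = true) by (unfold tie_test in E; rewrite !andb_true_iff in E; tauto).
        rewrite round_up_if_odd_half, Z.odd_sub, Ho. cbn [xorb andb negb Z.odd].
        pose proof (Z.div_mod m 2 ltac:(lia)) as D. rewrite Zmod_odd, Ho in D. apply div_eq; lia.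
      - rewrite round_up_if_odd_half. destruct (Z.odd m); reflexivity. }
    rewrite Hr. split; [|split]; intros Ho; rewrite Ho in *; cbn [andb].
    - reflexivity.
    - intros Hne. destruct (tie_test f z q m) eqn:E; [exfalso|reflexivity].
      apply Hne, Ht; try reflexivity. unfold tie_test in E; rewrite !andb_true_iff in E; tauto.
    - intros He. destruct (Z.even (m / 2)) eqn:Ev.
      + rewrite (proj2 (Ht eq_refl eq_refl) He). cbn [negb]. split; [auto|]. apply Z.even_spec, Ev.
      + replace (tie_test f z q m) with false
          by (unfold tie_test; rewrite Ev, andb_false_r; reflexivity).
        cbn [negb]. split; [auto|]. apply Z.even_spec. rewrite Z.even_add, Ev. reflexivity. }
  pose proof (half_even_range _ _ _ _ Hh) as Hr.
  assert (HA : 2 ^ (prec f - 1) <= m / 2 < 2 ^ prec f).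
  { split; [apply Z.div_le_lower_bound|apply Z.div_lt_upper_bound]; lia. }
  clearbody r.
  destruct (Z.eqb_spec r (2 ^ prec f)) as [e|e].
  - destruct (Z.ltb_spec (emax f) (p + 1)).
    + apply overflows_half_even with m p r; try assumption. lia.
    + apply correctly_rounded_finite with m p r; try assumption; try lia.
      rewrite value_shift by lia. f_equal. rewrite e, P1, (Z.mul_comm 2), Z.div_mul by lia. lia.
  - destruct (Z.ltb_spec (emax f) p).
    + apply overflows_half_even with m p r; try assumption. lia.
    + apply correctly_rounded_finite with m p r; try assumption; try lia. reflexivity.
Qed.

Lemma normalized_range (w : Z) : 0 < w <= 10 ^ 19 ->
  0 <= leading_zeros64 w <= 63 /\ 2 ^ 63 <= 2 ^ leading_zeros64 w * w < 2 ^ 64.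
Proof.
  intros Hw. unfold leading_zeros64. pose proof (Z.log2_spec w ltac:(lia)) as S.
  assert (Z.log2 w < 64) by (apply Z.log2_lt_pow2; lia).
  pose proof (Z.log2_nonneg w).
  assert (E1 : 2 ^ 63 = 2 ^ (63 - Z.log2 w) * 2 ^ Z.log2 w) by (rewrite <- Z.pow_add_r by lia; f_equal; lia).
  assert (E2 : 2 ^ 64 = 2 ^ (63 - Z.log2 w) * 2 ^ Z.succ (Z.log2 w)) by (rewrite <- Z.pow_add_r by lia; f_equal; lia).
  assert (0 < 2 ^ (63 - Z.log2 w)) by (apply Z.pow_pos_nonneg; lia).
  split; [lia|]. rewrite E1, E2. split; [apply Z.mul_le_mono_pos_l|apply Z.mul_lt_mono_pos_l]; lia.
Qed.

Lemma significand_range (f : format) (z : Z) : 2 ^ 126 <= z < 2 ^ 128 ->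
  let u := z / 2 ^ 127 in
  0 <= u <= 1 /\ 2 ^ prec f <= z / 2 ^ (127 + u - (prec f + 1)) < 2 ^ (prec f + 1).
Proof.
  intros Hz u. pose proof (prec_cases f).
  pose proof (div_bounds z (2 ^ 127) ltac:(lia)) as B. fold u in B.
  assert (Hu : u = 0 \/ u = 1) by lia.
  split; [lia|].
  assert (0 < 2 ^ (127 + u - (prec f + 1))) by (apply Z.pow_pos_nonneg; lia).
  split; [apply Z.div_le_lower_bound|apply Z.div_lt_upper_bound]; try assumption;
    rewrite <- Z.pow_add_r by lia.
  - replace (127 + u - (prec f + 1) + prec f) with (126 + u) by ring.
    destruct Hu as [-> | ->]; lia.
  - replace (127 + u - (prec f + 1) + (prec f + 1)) with (127 + u) by ring.
    destruct Hu as [-> | ->]; lia.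
Qed.

Theorem mainTheorem1 (f : format) (w q : Z) (hw : 0 <= w <= 10 ^ 19) :
  (-27 <= q <= 55 -> algorithm f w q <> None) /\
  (forall d : datum, algorithm f w q = Some d ->
     correctly_rounded f (IZR w * powerRZ 10 q)%R d).
Proof.
  unfold algorithm.
  destruct (Z.eqb_spec w 0) as [Hw0|Hw0]; cbn [orb].
  { split; [discriminate|]. intros d [= <-]. apply correctly_rounded_zero.
    subst w. rewrite Rmult_0_l. split; [lra|apply pow2_pos]. }
  destruct (Z.ltb_spec q (-342)) as [Hq1|Hq1].
  { split; [discriminate|]. intros d [= <-]. apply correctly_rounded_zero, tiny_input; assumption. }
  destruct (Z.ltb_spec 308 q) as [Hq2|Hq2].
  { split; [discriminate|]. intros d [= <-]. apply huge_input; lia. }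
  pose proof (normalized_range w ltac:(lia)) as [Hl HW].
  cbv zeta. set (l := leading_zeros64 w) in *. clearbody l.
  pose proof (product_range f (2 ^ l * w) q ltac:(lia) HW) as Hz.
  pose proof (significand_range f _ Hz) as [Hu Hm]. cbv zeta in Hu, Hm.
  destruct (andb (Z.eqb _ _) (negb _)) eqn:Hab.
  { split; [|discriminate]. intros Hq _.
    rewrite andb_true_iff, negb_true_iff, andb_false_iff, !Z.leb_gt in Hab. lia. }
  split; [intros _; case (Z.leb _ (emin f - 64)); [|case (Z.leb _ (emin f))]; intros Hn; discriminate Hn|].
  assert (Hab' : product f (2 ^ l * w) q mod 2 ^ 64 <> 2 ^ 64 - 1 \/ -27 <= q <= 55).
  { rewrite andb_false_iff, negb_false_iff, andb_true_iff, !Z.leb_le, Z.eqb_neq in Hab. exact Hab. }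
  clear Hab. pose proof (prec_cases f) as HPf.
  set (u := product f (2 ^ l * w) q / 2 ^ 127) in *. clearbody u.
  set (e := 127 + u - (prec f + 1)) in *.
  pose proof (bracket f (2 ^ l * w) q e ltac:(lia) HW ltac:(lia) Hab') as HB. cbv zeta in HB.
  pose proof (exact_tie_test f (2 ^ l * w) q e ltac:(lia) HW ltac:(lia) Hm) as HT1.
  pose proof (tie_test_exact f (2 ^ l * w) q e HW ltac:(lia) Hm) as HT2.
  set (z := product f (2 ^ l * w) q) in *. clearbody z.
  set (m := z / 2 ^ e) in *. clearbody m.
  set (p := 217706 * q / 2 ^ 16 + 63 - l + u).
  (* The quotient approximating q * log2 10 occurs in both [p] and [table_exponent q] and
     cancels. *)
  assert (Hp : p - prec f + l + table_exponent q - q = 64 + e) by (unfold p, e, table_exponent; lia).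
  pose proof (table_exponent_bounds q) as HK.
  clearbody p.
  set (x := (IZR w * powerRZ 10 q)%R).
  pose proof (scale_factor_pos l q) as HS.
  assert (Hx : (IZR m * pow2 (p - prec f) <= x < IZR (m + 1) * pow2 (p - prec f))%R).
  { split; [apply Rmult_le_reg_r with (scale_factor l q)|apply Rmult_lt_reg_r with (scale_factor l q)];
      try assumption; unfold x;
      rewrite <- scaled_input, <- (scaled_significand _ q l (64 + e)) by lia;
      [apply IZR_le|apply IZR_lt]; apply HB. }
  assert (Htie : 2 ^ l * w * num q = m * den q * 2 ^ (64 + e) <-> x = (IZR m * pow2 (p - prec f))%R).
  { split; intros H.
    - apply Rmult_eq_reg_r with (scale_factor l q); [|lra]. unfold x.
      rewrite <- scaled_input, <- (scaled_significand _ q l (64 + e)), H by lia. reflexivity.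
    - apply eq_IZR. rewrite scaled_input, (scaled_significand _ q l (64 + e) (p - prec f)) by lia.
      fold x. rewrite H. reflexivity. }
  assert (Hx0 : (0 < x)%R) by (apply input_pos; lia).
  assert (Hm0 : 0 < m) by (assert (0 < 2 ^ prec f) by (apply Z.pow_pos_nonneg; lia); lia).
  intros d Hd.
  destruct (Z.leb_spec p (emin f - 64)) as [Hp1|Hp1].
  (* Here [x] is below 2^(p + 1), hence below 2^(emin - 63 + 1), which is within the zero bound
     since [prec f <= 53]. *)
  { injection Hd as <-. apply correctly_rounded_zero. split; [lra|].
    eapply Rlt_le_trans; [apply Hx|].
    apply Rle_trans with (pow2 (prec f + 1) * pow2 (p - prec f))%R.
    - apply Rmult_le_compat_r; [apply Rlt_le, pow2_pos|]. rewrite pow2_IZR by lia. apply IZR_le.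
      lia.
    - rewrite <- pow2_add. apply pow2_le. lia. }
  destruct (Z.leb_spec p (emin f)) as [Hp2|Hp2]; injection Hd as <-.
  - apply subnormal_correct; try assumption; [lia|].
    intros a s. apply dyadic_no_tie; [lia|].
    (* As [l <= 63], an exponent [p] of at most -126 forces [q <= -28]. *)
    assert (emin f <= -126) by (destruct f; simpl; lia). lia.
  - apply normal_correct; try assumption; [lia|].
    intros Ho Ev. rewrite <- Htie. split; [apply HT2|apply HT1; assumption].
Qed.
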